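(* Let $\Sigma$ be a finite alphabet and let $X\subset\Sigma^{\mathbb Z}$ be a subshift that has a strictly positive $g$-function. Then $X$ is of finite type.
   Context: $\Sigma$ is a finite alphabet; a subshift $X\subset\Sigma^{\mathbb Z}$ is a closed shift-invariant set. A finite word is admissible for $X$ if it appears in a point of $X$. $X$ is of finite type if its admissible words are defined by excluding finitely many words from appearing as subwords, i.e. there is a finite set $F$ of words such that $X$ is the set of all $x\in\Sigma^{\mathbb Z}$ containing no subword from $F$. For an interval $I$ of integers, $X_I=\{(x_j)_{j\in I}: x\in X\}$, with the topology inherited from the product topology. For $x^-\in X_{(-\infty,0]}$: $\Gamma_1^+(x^-)=\{\sigma\in\Sigma: (x^-,\sigma)\in X_{(-\infty,1]}\}$. A $g$-function for $X$ is a continuous mapping $g:\{(x^-,\sigma)\in X_{(-\infty,0]}\times\Sigma:\sigma\in\Gamma_1^+(x^-)\}\to[0,1]$ such that $\sum_{\alpha\in\Gamma_1^+(x^-)}g(x^-,\alpha)=1$ for all $x^-\in X_{(-\infty,0]}$. It is strictly positive if $g(x^-,\alpha)>0$ for all $(x^-,\alpha)$ in its domain. *)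

(* Defs.v *)
From mathcomp Require Import all_boot all_order all_algebra.
From mathcomp Require Import all_classical all_reals all_analysis.

Set Implicit Arguments.
Unset Strict Implicit.
Unset Printing Implicit Defensive.

Import Order.TTheory GRing.Theory Num.Theory.
Import numFieldNormedType.Exports.
Local Open Scope classical_set_scope.
Local Open Scope ring_scope.

(* Sigma^J, with the product of the discrete topologies. *)
Notation config Sigma J := {ptws J -> discrete_topology Sigma}.

Definition coords (I : interval int) : Type := {j : int | j \in I}.

Definition shift (Sigma : finType) (x : config Sigma int) : config Sigma int :=
  fun i => x (i + 1).

(* Shift-invariance is the equality [shift X = X], not just an inclusion. *)
Definition subshift (Sigma : finType) (X : set (config Sigma int)) : Prop :=
  closed X /\ [set shift x | x in X] = X.

Definition appears (Sigma : finType) (w : seq Sigma) (x : config Sigma int) :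
    Prop :=
  exists i : int, mkseq (fun k => x (i + k%:Z) : Sigma) (size w) = w.

Definition finite_type (Sigma : finType) (X : set (config Sigma int)) : Prop :=
  exists2 F : set (seq Sigma), finite_set F &
    X = [set x | forall w, F w -> ~ appears w x].

Definition restr (Sigma : finType) (I : interval int) (x : config Sigma int) :
    config Sigma (coords I) :=
  fun j => x (val j).
Arguments restr {Sigma} I x.

(* X_I *)
Definition proj_shift (Sigma : finType) (X : set (config Sigma int))
    (I : interval int) : set (config Sigma (coords I)) :=
  [set restr I x | x in X].
Arguments proj_shift {Sigma} X I.

(* (x^-, a): the only j <= 1 that is not <= 0 is j = 1, where the value is a. *)
Definition append (Sigma : finType) (xm : config Sigma (coords `]-oo, 0]))
    (a : Sigma) : config Sigma (coords `]-oo, 1]) :=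
  fun j => oapp xm a (insub (val j)).
Arguments append {Sigma} xm a.

(* Gamma_1^+(x^-) *)
Definition followers (Sigma : finType) (X : set (config Sigma int))
    (xm : config Sigma (coords `]-oo, 0])) : set Sigma :=
  [set a | proj_shift X `]-oo, 1] (append xm a)].

Definition g_domain (Sigma : finType) (X : set (config Sigma int)) :
    set (config Sigma (coords `]-oo, 0]) * discrete_topology Sigma) :=
  [set p | proj_shift X `]-oo, 0] p.1 /\ followers X p.1 p.2].

(* g is a total function, of which only the restriction to [g_domain X] is
   constrained; continuity is for the subspace topology on [g_domain X]. *)
Definition g_function (R : realType) (Sigma : finType)
    (X : set (config Sigma int))
    (g : config Sigma (coords `]-oo, 0]) * discrete_topology Sigma -> R) :
    Prop :=
  [/\ {within g_domain X, continuous g},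
      forall p, g_domain X p -> 0 <= g p <= 1 &
      forall xm, proj_shift X `]-oo, 0] xm ->
        \sum_(a : Sigma | a \in followers X xm) g (xm, a) = 1].

Definition strictly_positive (R : realType) (Sigma : finType)
    (X : set (config Sigma int))
    (g : config Sigma (coords `]-oo, 0]) * discrete_topology Sigma -> R) :
    Prop :=
  forall p, g_domain X p -> 0 < g p.

(* Main.v *)
(** Closedness of [X] gives upper semicontinuity of the follower sets: if pasts
    [x_t] converge to [x] and their follower sets are all equal to [S], then [S]
    is contained in the follower set of [x].  Since [g] is continuous and sums to
    1 over the follower set of each [x_t], it also sums to 1 over [S] at [x];
    strict positivity then leaves no room for any other follower of [x].  So the
    follower set is a locally constant function of the past and, by compactness,
    depends only on the last [N + 1] symbols, for some uniform [N].  Admissible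
    words overlapping in [N + 1] symbols can therefore be glued one symbol at a
    time, and [X] is defined by excluding the inadmissible words of length [N + 2].

    Compactness enters through limits along an ultrafilter: over a finite
    alphabet, every family of configurations is eventually constant at each
    coordinate. *)
Require Import Defs.
From mathcomp Require Import all_boot all_order all_algebra.
From mathcomp Require Import all_classical all_reals all_analysis.
From mathcomp Require Import zify.
Set Implicit Arguments.
Unset Strict Implicit.
Unset Printing Implicit Defensive.
Import Order.TTheory GRing.Theory Num.Theory.
Import numFieldNormedType.Exports.
Local Open Scope classical_set_scope.
Local Open Scope ring_scope.

(** * Limits of configurations along ultrafilters *)

Lemma ultra_finite_eq (I : finType) T (U : set_system T) (f : T -> I) :
  UltraFilter U -> exists a, \forall t \near U, f t = a.
Proof.
move=> UU; apply: contrapT => nU.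
have : \forall t \near U, forall a, f t <> a.
  apply: filter_forall => a.
  have [|//] := in_ultra_setVsetC [set t | f t = a] UU.
  by move=> Ua; case: nU; exists a.
by move=> /filter_ex[t /(_ (f t))].
Qed.

Section configurations.
Variable Sigma : finType.
Implicit Types (X : set (config Sigma int)) (x y z : config Sigma int).

Lemma cvg_config (J T : Type) (F : set_system T) (f : T -> config Sigma J)
    (c : config Sigma J) :
  Filter F -> (forall j, \forall t \near F, f t j = c j) -> f @ F --> c.
Proof.
move=> FF fc; apply/cvg_sup => j /= A [B [[C oC <-] /= Cc BA]].
rewrite nbhs_simpl /=; apply: filterS (fc j) => t ftj.
by apply: BA; rewrite /= ftj.
Qed.

Lemma ultra_config T (U : set_system T) (f : T -> config Sigma int) :
  UltraFilter U -> exists x, forall j, \forall t \near U, f t j = x j.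
Proof.
move=> UU.
have /choice[x fx] : forall j, exists a : Sigma, \forall t \near U, f t j = a.
  by move=> j; exact: (ultra_finite_eq (fun t => f t j : Sigma)).
by exists x.
Qed.

Lemma closed_config T (U : set_system T) (f : T -> config Sigma int) X x :
  ProperFilter U -> closed X -> (\forall t \near U, X (f t)) ->
  (forall j, \forall t \near U, f t j = x j) -> X x.
Proof.
by move=> UU Xcl Xf fx; exact: (closed_cvg X Xcl Xf _ (cvg_config _ fx)).
Qed.

(** * Follower sets under limits of pasts *)

Lemma followers_restrP X y a :
  followers X (restr `]-oo, 0] y) a <->
  exists z, [/\ X z, forall i, i <= 0 -> z i = y i & z 1 = a].
Proof.
split=> [[z Xz eqz]|[z [Xz zy za]]].
- have zE (i : int) (i1 : i \in `]-oo, (1 : int)]) :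
      z i = append (restr `]-oo, 0] y) a (exist _ i i1).
    by rewrite -eqz.
  exists z; split=> // [i i0|].
    have i1 : i \in `]-oo, (1 : int)] by rewrite in_itv /=; lia.
    have i0' : i \in `]-oo, (0 : int)] by rewrite in_itv.
    by rewrite (zE i i1) /append /= (insubT (fun j => j \in `]-oo, 0]) i0').
  by rewrite (zE 1) // /append insubF.
- exists z => //; apply/funext => -[i /= i1]; rewrite /restr /append /=.
  case: insubP => [u + /= uE|/=]; rewrite in_itv /=.
    by move=> i0; rewrite uE zy.
  move: i1; rewrite in_itv /= => i1 i0.
  by have -> : i = 1 by lia.
Qed.

Lemma followers_restr0 X x : X x -> followers X (restr `]-oo, 0] x) (x 1).
Proof. by move=> Xx; apply/followers_restrP; exists x. Qed.

(** The points of [X] that continue the pasts of the [f t] by [a] have a limit along [U]; it lies in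
    [X] and continues the past of [x] by [a]. *)
Lemma followers_ultra_sub T (U : set_system T) (f : T -> config Sigma int)
    X x a :
  UltraFilter U -> closed X ->
  (forall j, \forall t \near U, f t j = x j) ->
  (\forall t \near U, followers X (restr `]-oo, 0] (f t)) a) ->
  followers X (restr `]-oo, 0] x) a.
Proof.
move=> UU Xcl fx fa.
have /choice[z zP] : forall t, exists z,
    followers X (restr `]-oo, 0] (f t)) a ->
    [/\ X z, forall i, i <= 0 -> z i = f t i & z 1 = a].
  move=> t; have [/followers_restrP[z zP]|na] :=
    pselect (followers X (restr `]-oo, 0] (f t)) a).
    by exists z.
  (* A default value: by hypothesis this case fails for almost all [t]. *)
  by exists x.
have [w zw] := ultra_config z UU.
apply/followers_restrP; exists w; split.
- by apply: (closed_config _ Xcl _ zw); apply: filterS fa => t /zP[].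
- move=> i i0.
  have [t [[<- <-] /zP[_ /(_ i i0)]]] // :=
    filter_ex (filterI (filterI (zw i) (fx i)) fa).
- by have [t [<- /zP[]]] := filter_ex (filterI (zw 1) fa).
Qed.

(** Continuity of [g] is relative to [g_domain X], so the convergence of the pasts has to be refined
    to one within that set, for a fixed letter [a]. *)
Lemma g_function_cvg (R : realType) X
    (g : config Sigma (coords `]-oo, 0]) * discrete_topology Sigma -> R)
    T (U : set_system T) (f : T -> config Sigma int) x a :
  ProperFilter U -> {within g_domain X, continuous g} ->
  (\forall t \near U, g_domain X (restr `]-oo, 0] (f t), a)) ->
  g_domain X (restr `]-oo, 0] x, a) ->
  (forall j, \forall t \near U, f t j = x j) ->
  g (restr `]-oo, 0] (f t), a) @[t --> U] --> g (restr `]-oo, 0] x, a).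
Proof.
move=> UU gc Df Dx fx.
have h : (fun t => (restr `]-oo, 0] (f t), a)) @ U -->
    within (g_domain X)
      (nbhs (restr `]-oo, 0] x, a : discrete_topology Sigma)).
  have := cvg_pair (cvg_config _ (fun j => fx (val j))) (cvg_cst a).
  move=> cfa A /= /cfa; rewrite !nbhs_simpl /= => hA.
  by apply: filterS (filterI hA Df) => t [] /=; apply.
move=> A gA; apply: (h (g @^-1` A)).
by rewrite (nbhs_subspace_in Dx); exact: gc gA.
Qed.

Lemma followers_ultra (R : realType) X
    (g : config Sigma (coords `]-oo, 0]) * discrete_topology Sigma -> R)
    T (U : set_system T) (f : T -> config Sigma int) x :
  closed X -> g_function X g -> strictly_positive X g -> UltraFilter U ->
  (forall t, X (f t)) -> (forall j, \forall t \near U, f t j = x j) ->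
  \forall t \near U,
    followers X (restr `]-oo, 0] (f t)) = followers X (restr `]-oo, 0] x).
Proof.
move=> Xcl [gc _ g1] gpos UU Xf fx.
have Xx : X x by apply: (closed_config _ Xcl _ fx); exact: nearW.
(* There are finitely many subsets of [Sigma], so the follower set of [f t] is constant along
   [U]. *)
have [S fS] := ultra_finite_eq
  (fun t => [set a in followers X (restr `]-oo, 0] (f t))]%SET) UU.
have Sf a : a \in S ->
    \forall t \near U, followers X (restr `]-oo, 0] (f t)) a.
  move=> aS; apply: filterS fS => t SE.
  by move: aS; rewrite -SE inE => /set_mem.
have Sx a : a \in S -> followers X (restr `]-oo, 0] x) a.
  by move=> aS; exact: (followers_ultra_sub UU Xcl fx (Sf a aS)).
have sumS : \sum_(a in S) g (restr `]-oo, 0] x, a) = 1.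
  have sumcv : \sum_(a in S) g (restr `]-oo, 0] (f t), a) @[t --> U] -->
      \sum_(a in S) g (restr `]-oo, 0] x, a).
    apply: cvg_big => [|a aS]; first exact: add_continuous.
    apply: g_function_cvg => //; last by split; [exists x|exact: Sx].
    by apply: filterS (Sf a aS) => t ?; split=> //; exists (f t).
  have sumcv1 :
      \sum_(a in S) g (restr `]-oo, 0] (f t), a) @[t --> U] --> (1 : R).
    apply: cvg_near_cst; apply: filterS fS => t <-.
    rewrite -(g1 (restr `]-oo, 0] (f t))); last by exists (f t).
    by apply: eq_bigl => a; rewrite inE.
  exact: (cvg_unique _ sumcv sumcv1).
have xS a : followers X (restr `]-oo, 0] x) a -> a \in S.
  move=> xa; apply/negPn/negP => aS.
  have : \sum_(b | b \in followers X (restr `]-oo, 0] x))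
      g (restr `]-oo, 0] x, b) = 1.
    by apply: g1; exists x.
  (* Both the full sum and its part over [S] equal 1, so the terms outside [S] sum to 0; being
     positive, there are none. *)
  rewrite (bigID (mem S)) /= (eq_bigl (mem S)) => [|b]; last first.
    by rewrite andb_idl // => /Sx /mem_set.
  rewrite sumS -[RHS]addr0 => /addrI s0.
  have gp b : (b \in followers X (restr `]-oo, 0] x)) && (b \notin S) ->
      0 < g (restr `]-oo, 0] x, b).
    by move=> /andP[/set_mem xb _]; apply: gpos; split=> //; exists x.
  have := gp a; rewrite (psumr_eq0P (fun b bP => ltW (gp b bP)) s0) ?ltxx.
    by rewrite mem_set // aS => /(_ isT).
  by rewrite mem_set.
apply: filterS fS => t SE; apply/seteqP; split=> a /=.
  by move=> fa; apply: Sx; rewrite -SE inE mem_set.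
by move=> /xS; rewrite -SE inE => /set_mem.
Qed.

Lemma followers_window (R : realType) X
    (g : config Sigma (coords `]-oo, 0]) * discrete_topology Sigma -> R) :
  closed X -> g_function X g -> strictly_positive X g ->
  exists N : nat, forall y z, X y -> X z ->
    (forall i, - N%:Z <= i <= 0 -> y i = z i) ->
    followers X (restr `]-oo, 0] y) = followers X (restr `]-oo, 0] z).
Proof.
move=> Xcl gX gpos; apply: contrapT => noN.
have /choice[h hP] : forall N : nat,
    exists p : config Sigma int * config Sigma int,
    [/\ X p.1, X p.2, forall i, - N%:Z <= i <= 0 -> p.1 i = p.2 i &
      followers X (restr `]-oo, 0] p.1) <> followers X (restr `]-oo, 0] p.2)].
  move=> N; apply: contrapT => nex; apply: noN; exists N => y z Xy Xz yz.
  by apply: contrapT => neq; apply: nex; exists (y, z).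
(* Were there no uniform window, the counterexample pairs [h n] would have limits [y] and [z] along
   an ultrafilter finer than [\oo]. These agree on all of the past, yet the follower sets in [h n]
   tend to theirs. *)
have [U [UU ooU]] := ultraFilterLemma (eventually_filter : ProperFilter \oo).
have [y hy] := ultra_config (fun n => (h n).1) UU.
have [z hz] := ultra_config (fun n => (h n).2) UU.
have yz i : i <= 0 -> y i = z i.
  move=> i0; have hi : \forall n \near U, (h n).1 i = (h n).2 i.
    apply: ooU; exists `|i|%N => // n /= ni.
    by have [_ _ -> //] := hP n; lia.
  by have [n [[<- <-]]] := filter_ex (filterI (filterI (hy i) (hz i)) hi).
have Xy n : X (h n).1 by have [] := hP n.
have Xz n : X (h n).2 by have [] := hP n.
have Uy := followers_ultra Xcl gX gpos UU Xy hy.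
have Uz := followers_ultra Xcl gX gpos UU Xz hz.
have [n [ny nz]] := filter_ex (filterI Uy Uz).
have [_ _ _] := hP n; apply; rewrite ny nz; congr (followers X _).
by apply/funext => -[i i0]; apply: yz; have := i0; rewrite in_itv.
Qed.

(** * Translation, admissible windows and gluing *)

Lemma subshift_translate X x (k : int) :
  subshift X -> X x -> X (fun i => x (i + k)).
Proof.
move=> [_ Xs] Xx; elim/int_ind: k => [|n IH|n IH].
- by have -> : (fun i => x (i + 0)) = x by apply/funext => i; rewrite addr0.
- rewrite -Xs; exists (fun i => x (i + n%:Z)) => //.
  by apply/funext => i; rewrite /Defs.shift; congr (x _); lia.
- move: IH; rewrite -{1}Xs => -[y Xy yE].
  suff -> : (fun i => x (i + - n.+1%:Z)) = y by [].
  apply/funext => i; have := congr1 (fun c : config Sigma int => c (i - 1)) yE.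
  rewrite /Defs.shift subrK => ->.
  by congr (x _); lia.
Qed.

Definition forbidden X (n : nat) : set (seq Sigma) :=
  [set w | size w = n /\ forall x, X x -> ~ appears w x].

Lemma finite_forbidden X n : finite_set (forbidden X n).
Proof.
apply: (@sub_finite_set _ _ [set tval t | t in [set: n.-tuple Sigma]]).
  by move=> w [/eqP wn _]; exists (Tuple wn).
exact/finite_image/finite_finset.
Qed.

Lemma window_admissible X n x (m : int) :
  subshift X -> (forall w, forbidden X n w -> ~ appears w x) ->
  exists2 y, X y & forall i, m <= i < m + n%:Z -> y i = x i.
Proof.
move=> Xs xF; apply: contrapT => noy.
apply: (xF (mkseq (fun k => x (m + k%:Z) : Sigma) n)); last first.
  by exists m; rewrite size_mkseq.
split=> [|y Xy [j]]; first by rewrite size_mkseq.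
rewrite size_mkseq => yx; apply: noy.
exists (fun i => y (i + (j - m)));
  first exact: (subshift_translate (j - m) Xs Xy).
move=> i im; have kn : (`|i - m| < n)%N by lia.
have iE : i = m + `|i - m|%N%:Z by lia.
(* The default [x i] is never reached, since the index is below [n]. *)
have := congr1 (fun s => nth (x i : Sigma) s `|i - m|%N) yx.
rewrite !nth_mkseq // -iE => <-; congr (y _); lia.
Qed.

(** Once [e] is translated to 0, the two pasts have equal follower sets, so the next symbol of [z]
    may follow the past of [y]. *)
Lemma glue_admissible X (N : nat) y z (e : int) :
  subshift X ->
  (forall y z, X y -> X z -> (forall i, - N%:Z <= i <= 0 -> y i = z i) ->
    followers X (restr `]-oo, 0] y) = followers X (restr `]-oo, 0] z)) ->
  X y -> X z -> (forall i, e - N%:Z <= i <= e -> y i = z i) ->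
  exists w, [/\ X w, forall i, i <= e -> w i = y i & w (e + 1) = z (e + 1)].
Proof.
move=> Xs XN Xy Xz yz.
pose y' : config Sigma int := fun i => y (i + e).
pose z' : config Sigma int := fun i => z (i + e).
have Xy' : X y' by exact: (subshift_translate e Xs Xy).
have Xz' : X z' by exact: (subshift_translate e Xs Xz).
have := followers_restr0 Xz'.
rewrite -(XN y' z') // => [/followers_restrP[w [Xw wy wz]]|i iN]; last first.
  by apply: yz; lia.
exists (fun i => w (i - e)); split;
  first exact: (subshift_translate (- e) Xs Xw).
- by move=> i ie; rewrite wy ?/y' ?subrK //; lia.
- by rewrite (addrC e) addrK wz.
Qed.

End configurations.

Theorem corollary2p2 (R : realType) (Sigma : finType)
    (X : set (config Sigma int)) :
  subshift X ->
  (exists g : config Sigma (coords `]-oo, 0]) * discrete_topology Sigma -> R,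
     g_function X g /\ strictly_positive X g) ->
  finite_type X.
Proof.
move=> Xs [g [gX gpos]]; have [N XN] := followers_window (proj1 Xs) gX gpos.
exists (forbidden X N.+2); first exact: finite_forbidden.
apply/seteqP; split=> [x Xx w [_]|x /= xF]; first exact.
have admissible (m : int) (L : nat) : exists2 y, X y &
    forall i, m <= i < m + (N.+2 + L)%:Z -> y i = x i.
  elim: L => [|L [y Xy yx]].
    by rewrite addn0; exact: window_admissible.
  (* [e] is the last position where [y] is known to match [x]. The window of length [N.+2] from
     [e - N] to [e + 1] overlaps the matched part in [N.+1] symbols and adds one. *)
  pose e := m + (N.+1 + L)%:Z.
  have [z Xz zx] := window_admissible (e - N%:Z) Xs xF.
  have [|w [Xw wy we]] := glue_admissible (e := e) Xs XN Xy Xz.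
    by move=> i ie; rewrite yx ?zx //; rewrite /e in ie *; lia.
  exists w => // i im; have [ie|ei] := leP i e.
    by rewrite wy // yx //; rewrite /e in ie; lia.
  have -> : i = e + 1 by rewrite /e in ei *; lia.
  by rewrite we zx //; lia.
have /choice[y yP] : forall n : nat, exists y,
    X y /\ forall i, - n%:Z <= i <= n%:Z -> y i = x i.
  move=> n; have [y Xy yx] := admissible (- n%:Z) (n + n)%N.
  by exists y; split=> // i ni; apply: yx; lia.
(* The points [y n] of [X] match [x] on windows exhausting the integers, so they converge to [x]. *)
apply: (closed_config (U := \oo) (f := y)) (proj1 Xs) _ _.
  by apply: nearW => n; have [] := yP n.
move=> j; exists `|j|%N => // n /= jn.
by have [_ -> //] := yP n; lia.
Qed.
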